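(* Let $b,c,r\in\mathbb{N}$, $a\in\mathbb{N}_0$ with $0\le b-a\le c$. Then for every $n\in\mathbb{N}$, \[ \left|\gamma-\frac{1}{r^{cn}}\sum_{k=0}^{cn}(-1)^{k+cn}\binom{cn}{k}\binom{rk+(a+c)n}{cn}S_{rk+bn}\right|<\left(\frac{b^{b/r}(c+a-b)^{c+a-b}(b-a)^{b-a}}{(b+cr)^{c+b/r}}\right)^n . \]
   Context: $\gamma$ is Euler's constant; $S_n=\sum_{k=1}^n\frac1k-\log(n+1)$. The convention $0^0=1$ is used. *)

(* Defs.v *)
From Stdlib Require Import Reals Lra Lia.
From Coquelicot Require Import Coquelicot.

Open Scope R_scope.

Definition harmonic (n : nat) : R := sum_n_m (fun k : nat => / INR k) 1 n.

Definition Euler_gamma : R :=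
  real (Lim_seq (fun n : nat => harmonic n - ln (INR n))).

Definition S_seq (n : nat) : R := harmonic n - ln (INR (n + 1)).

Lemma harmonic_S (n : nat) : harmonic (S n) = harmonic n + / INR (S n).
Proof.
unfold harmonic; rewrite sum_n_Sm; [reflexivity | lia].
Qed.

Lemma ln_succ_bounds (x : R) :
  0 < x -> / (x + 1) <= ln (x + 1) - ln x <= / x.
Proof.
intros Hx.
assert (Hln : forall y : R, 0 < y -> ln y <= y - 1).
{ intros y Hy. rewrite <- (ln_exp (y - 1)). apply ln_le; [exact Hy |].
  pose proof (exp_ineq1_le (y - 1)); lra. }
split.
- pose proof (Hln (x / (x + 1)) ltac:(apply Rdiv_lt_0_compat; lra)) as H.
  rewrite ln_div in H by lra.
  replace (x / (x + 1) - 1) with (- / (x + 1)) in H by (field; lra).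
  lra.
- pose proof (Hln ((x + 1) / x) ltac:(apply Rdiv_lt_0_compat; lra)) as H.
  rewrite ln_div in H by lra.
  replace ((x + 1) / x - 1) with (/ x) in H by (field; lra).
  lra.
Qed.

(* Euler_gamma is a genuine limit, not a default value of Lim_seq. *)
Lemma is_lim_seq_Euler_gamma :
  is_lim_seq (fun n : nat => harmonic n - ln (INR n)) Euler_gamma.
Proof.
apply Lim_seq_correct'.
enough (Hex : ex_finite_lim_seq (fun n : nat => harmonic (S n) - ln (INR (S n)))).
{ destruct Hex as [l Hl]; exists l; now apply is_lim_seq_incr_1. }
apply ex_finite_lim_seq_decr with 0.
- intros n. rewrite (harmonic_S (S n)), (S_INR (S n)).
  pose proof (ln_succ_bounds (INR (S n)) (lt_0_INR (S n) ltac:(lia))); lra.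
- intros n. enough (ln (INR (S n)) + / INR (S n) <= harmonic (S n)).
  { pose proof (Rinv_0_lt_compat _ (lt_0_INR (S n) ltac:(lia))); lra. }
  induction n as [|n IH].
  + rewrite harmonic_S; unfold harmonic; rewrite sum_n_m_zero by lia.
    simpl INR; rewrite ln_1; unfold zero; simpl; lra.
  + rewrite (harmonic_S (S n)), (S_INR (S n)).
    pose proof (ln_succ_bounds (INR (S n)) (lt_0_INR (S n) ltac:(lia))); lra.
Qed.

(* Main.v *)
(* Put [u_k = gamma - S_k], [N = c n], [m = (b - a) n], and let [L u] be the weighted sum of the
   [u_(rk + bn)] in the theorem.  The weights sum to [1], so the quantity to bound is [L u].
   Here [u_k] is the [k]-th moment on [0, 1] of [1/(1-x) + 1/ln x], which is a Stieltjes function: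
   a positive superposition of the kernels [1/(x+t)], [t > 0].  On the moments of one kernel, [N]
   integrations by parts give, up to sign,
     [r^(-N) t^m int_0^1 x^((a+c)n) (1 - x^r)^N / (x+t)^(N+1) dx],
   and AM-GM, used once for [t^(b-a) x^(c+a-b) / (x+t)^c] and once for [x^b (1 - x^r)^c], bounds it
   by [rate^n int_0^1 dx/(x+t)].  By positivity [|L u| <= rate^n u_0], and [u_0 = gamma < 1].

   The Stieltjes representation is replaced by approximation with finite positive sums of kernels:
   [1/(1-x) + 1/ln x] is the mean over [s] in [0, 1] of [(1 - x^s)/(1-x)], and [x^(s-1)] is a limit
   of products of [(x + b_i)/(x + a_i)] with [a_i <= b_i <= a_(i+1)] in geometric progression, whose
   partial fractions have positive coefficients because of the interlacing. *)
Require Import Defs.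
From Stdlib Require Import Reals Factorial Lra Lia.
From Coquelicot Require Import Coquelicot.
From Stdlib Require Import List.

Open Scope R_scope.

(** * Finite differences of polynomials *)

(* [q] is a polynomial in its index, of degree at most [d], with [l] the coefficient of [k ^ d]. *)
Fixpoint poly_seq (d : nat) (l : R) (q : nat -> R) : Prop :=
  match d with
  | O => forall k, q k = l
  | S d' => poly_seq d' (INR d * l) (fun k => q (S k) - q k)
  end.

Lemma poly_seq_ext d : forall l q q', (forall k, q k = q' k) ->
  poly_seq d l q -> poly_seq d l q'.
Proof.
induction d as [|d IH]; cbn [poly_seq]; intros l q q' E H.
- intros k; rewrite <- E; auto.
- apply (IH _ (fun k => q (S k) - q k)); auto. intros k; now rewrite !E.
Qed.

Lemma poly_seq_shift d : forall l q, poly_seq d l q -> poly_seq d l (fun k => q (S k)).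
Proof.
induction d as [|d IH]; cbn [poly_seq]; intros l q H; auto.
exact (IH _ _ H).
Qed.

Lemma poly_seq_plus d : forall l l' q q', poly_seq d l q -> poly_seq d l' q' ->
  poly_seq d (l + l') (fun k => q k + q' k).
Proof.
induction d as [|d IH]; cbn [poly_seq]; intros l l' q q' H H'.
- intros k; now rewrite H, H'.
- rewrite Rmult_plus_distr_l. eapply poly_seq_ext; [|exact (IH _ _ _ _ H H')].
  intros k; simpl; ring.
Qed.

Lemma poly_seq_scal d c : forall l q, poly_seq d l q -> poly_seq d (c * l) (fun k => c * q k).
Proof.
induction d as [|d IH]; cbn [poly_seq]; intros l q H.
- intros k; now rewrite H.
- replace (INR (S d) * (c * l)) with (c * (INR (S d) * l)) by ring.
  eapply poly_seq_ext; [|exact (IH _ _ H)]. intros k; simpl; ring.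
Qed.

Lemma poly_seq_raise d : forall l q, poly_seq d l q -> poly_seq (S d) 0 q.
Proof.
induction d as [|d IH]; intros l q H.
- cbn [poly_seq] in *. intros k; rewrite !H; ring.
- change (poly_seq (S d) (INR (S (S d)) * 0) (fun k => q (S k) - q k)).
  rewrite Rmult_0_r. exact (IH _ _ H).
Qed.

Lemma poly_seq_const d c : poly_seq (S d) 0 (fun _ => c).
Proof.
induction d as [|d IH].
- apply poly_seq_raise with c; intros k; reflexivity.
- apply poly_seq_raise with 0; exact IH.
Qed.

(** The discrete product rule: the difference of [(al k + be) q_k] is
    [(al k + be) (q_(k+1) - q_k) + al q_(k+1)]. When [q] has degree at most [S d], both terms do
    too, with coefficients [al (S d) l] and [al l], which add up to [S (S d)] times [al l]. *)
Lemma poly_seq_mul_affine al be d : forall l q, poly_seq d l q ->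
  poly_seq (S d) (al * l) (fun k => (al * INR k + be) * q k).
Proof.
induction d as [|d IH]; intros l q H.
- cbn [poly_seq] in *. intros k; rewrite !H, S_INR; simpl; ring.
- assert (H1 : poly_seq (S d) (al * (INR (S d) * l))
     (fun k => (al * INR k + be) * (q (S k) - q k))) by exact (IH _ _ H).
  pose proof (poly_seq_scal _ al _ _ (poly_seq_shift _ _ _ H)) as H2.
  pose proof (poly_seq_plus _ _ _ _ _ H1 H2) as H3.
  change (poly_seq (S d) (INR (S (S d)) * (al * l))
   (fun k => (al * INR (S k) + be) * q (S k) - (al * INR k + be) * q k)).
  replace (INR (S (S d)) * (al * l)) with (al * (INR (S d) * l) + al * l)
    by (rewrite (S_INR (S d)); ring).
  eapply poly_seq_ext; [|exact H3]. intros k; cbv beta; rewrite (S_INR k); ring.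
Qed.

(** Pascal's rule followed by a shift of the index. When [g] carries an alternating sign,
    [g k + g (S k)] is up to sign a forward difference, so an alternating sum of order [S N] becomes
    one of order [N]. *)
Lemma sum_binomial_succ N (g : nat -> R) :
  sum_f_R0 (fun k => Binomial.C (S N) k * g k) (S N) =
  sum_f_R0 (fun k => Binomial.C N k * (g k + g (S k))) N.
Proof.
assert (C0 : forall n, Binomial.C n 0 = 1).
{ intros n; unfold Binomial.C; rewrite Nat.sub_0_r; change (fact 0) with 1%nat; simpl INR.
  field; apply INR_fact_neq_0. }
assert (Cn : forall n, Binomial.C n n = 1).
{ intros n; unfold Binomial.C; rewrite Nat.sub_diag; change (fact 0) with 1%nat; simpl INR.
  field; apply INR_fact_neq_0. }
rewrite (sum_eq (fun k => Binomial.C N k * (g k + g (S k)))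
  (fun k => Binomial.C N k * g k + Binomial.C N k * g (S k))) by (intros; ring).
rewrite sum_plus.
destruct N as [|M].
- cbn [sum_f_R0]. rewrite !C0, !Cn. ring.
- rewrite (decomp_sum _ (S (S M))) by lia. cbn [pred]. rewrite tech5, C0, Cn.
  rewrite (decomp_sum (fun k => Binomial.C (S M) k * g k) (S M)) by lia. cbn [pred].
  rewrite (tech5 (fun k => Binomial.C (S M) k * g (S k))), C0, Cn.
  rewrite (sum_eq (fun i => Binomial.C (S (S M)) (S i) * g (S i))
    (fun i => Binomial.C (S M) i * g (S i) + Binomial.C (S M) (S i) * g (S i))).
  + rewrite sum_plus. ring.
  + intros i Hi. rewrite <- pascal by lia. ring.
Qed.

Lemma alternating_sum_poly_seq N : forall l q, poly_seq N l q ->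
  sum_f_R0 (fun k => (-1) ^ (k + N) * Binomial.C N k * q k) N = INR (fact N) * l.
Proof.
induction N as [|N IH]; intros l q H.
- cbn [sum_f_R0 poly_seq] in *. rewrite H. unfold Binomial.C; simpl. field.
- rewrite (sum_eq _ (fun k => Binomial.C (S N) k * ((-1) ^ (k + S N) * q k))) by (intros; ring).
  rewrite sum_binomial_succ.
  rewrite (sum_eq _ (fun k => (-1) ^ (k + N) * Binomial.C N k * (q (S k) - q k))).
  + rewrite (IH _ _ H), fact_simpl, mult_INR. ring.
  + intros k _. replace (k + S N)%nat with (S (k + N)) by lia. simpl.
    replace (k + S N)%nat with (S (k + N)) by lia. simpl. ring.
Qed.

Lemma C_succ_succ e N : (N <= e)%nat ->
  Binomial.C (S e) (S N) = INR (S e) / INR (S N) * Binomial.C e N.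
Proof.
intros H. unfold Binomial.C. rewrite !fact_simpl, !mult_INR.
replace (S e - S N)%nat with (e - N)%nat by lia.
pose proof (INR_fact_neq_0 N). pose proof (INR_fact_neq_0 (e - N)).
pose proof (not_0_INR (S N) ltac:(lia)). field; auto.
Qed.

(** Induction through C(x, N+1) = x/(N+1) C(x-1, N) with [x = r k + E], an affine factor at each
    step. The bound [N <= E] keeps the upper index at least [N]; below that, [Binomial.C] with its
    truncated subtraction is not the binomial coefficient. *)
Lemma poly_seq_C r N : forall E, (N <= E)%nat ->
  poly_seq N (INR r ^ N / INR (fact N)) (fun k => Binomial.C (r * k + E) N).
Proof.
induction N as [|N IH]; intros E H.
- intros k. unfold Binomial.C. rewrite Nat.sub_0_r. change (fact 0) with 1%nat; simpl INR. simpl pow.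
  field; apply INR_fact_neq_0.
- destruct E as [|E]; [lia|].
  pose proof (poly_seq_mul_affine (INR r / INR (S N)) (INR (S E) / INR (S N)) _ _ _ (IH E ltac:(lia))) as P.
  replace (INR r ^ S N / INR (fact (S N))) with (INR r / INR (S N) * (INR r ^ N / INR (fact N))).
  + eapply poly_seq_ext; [|exact P]. intros k; cbv beta.
    replace (r * k + S E)%nat with (S (r * k + E)) by lia.
    rewrite C_succ_succ by lia. rewrite !(S_INR (_ + _)), (S_INR E), plus_INR, mult_INR.
    pose proof (not_0_INR (S N) ltac:(lia)). field; auto.
  + rewrite fact_simpl, mult_INR. simpl pow.
    pose proof (INR_fact_neq_0 N). pose proof (not_0_INR (S N) ltac:(lia)). field; auto.
Qed.

(** For [i < N] the number [x - i] is one of the factors x, x-1, ..., x-N+1 of C(x, N), so the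
    quotient is still a polynomial, of degree [N - 1]. *)
Lemma poly_seq_C_div r N : forall i E, (N <= E)%nat -> (i < N)%nat ->
  poly_seq N 0 (fun k => Binomial.C (r * k + E) N / INR (r * k + E - i)).
Proof.
induction N as [|N IH]; intros i E H Hi; [lia|].
destruct E as [|E]; [lia|].
pose proof (not_0_INR (S N) ltac:(lia)) as HN.
destruct i as [|i].
- pose proof (poly_seq_raise _ _ _ (poly_seq_scal _ (/ INR (S N)) _ _ (poly_seq_C r N E ltac:(lia)))) as P.
  eapply poly_seq_ext; [|exact P]. intros k; cbv beta.
  replace (r * k + S E)%nat with (S (r * k + E)) by lia.
  rewrite C_succ_succ, Nat.sub_0_r by lia.
  pose proof (not_0_INR (S (r * k + E)) ltac:(lia)). field; auto.
- pose proof (poly_seq_mul_affine (INR r / INR (S N)) (INR (S E) / INR (S N)) _ _ _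
    (IH i E ltac:(lia) ltac:(lia))) as P.
  rewrite Rmult_0_r in P.
  eapply poly_seq_ext; [|exact P]. intros k; cbv beta.
  replace (r * k + S E)%nat with (S (r * k + E)) by lia.
  rewrite C_succ_succ by lia. replace (S (r * k + E) - S i)%nat with (r * k + E - i)%nat by lia.
  rewrite !(S_INR (_ + _)), (S_INR E), plus_INR, mult_INR.
  pose proof (not_0_INR (r * k + E - i) ltac:(lia)). field; auto.
Qed.

(** * The weighted AM-GM inequality *)

(** Dividing [u] and [v] by their values [p s] and [q s] at equality reduces the claim to z^k <= exp
    (k (z - 1)): the two exponents then add up to zero. Zero exponents, where this division fails,
    are treated first with 0^0 = 1. *)
Lemma pow_mul_pow_le (p q : nat) (u v : R) : 0 <= u -> 0 <= v ->
  u ^ p * v ^ q * INR (p + q) ^ (p + q) <= INR p ^ p * INR q ^ q * (u + v) ^ (p + q).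
Proof.
intros Hu Hv.
destruct p as [|p'].
{ change (0 + q)%nat with q. rewrite !pow_O, !Rmult_1_l, Rmult_comm.
  apply Rmult_le_compat_l; [apply pow_le, pos_INR|]. apply pow_incr; lra. }
destruct q as [|q'].
{ rewrite Nat.add_0_r, !pow_O, !Rmult_1_r, Rmult_comm.
  apply Rmult_le_compat_l; [apply pow_le, pos_INR|]. apply pow_incr; lra. }
set (p := S p'). set (q := S q').
assert (Hp : 0 < INR p) by (apply lt_0_INR; unfold p; lia).
assert (Hq : 0 < INR q) by (apply lt_0_INR; unfold q; lia).
destruct (Req_dec (u + v) 0) as [E|E].
{ replace u with 0 by lra. replace v with 0 by lra. unfold p, q. simpl.
  rewrite !Rplus_0_l, !Rmult_0_l, !Rmult_0_r. lra. }
set (s := (u + v) / INR (p + q)).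
assert (Hpq : 0 < INR (p + q)) by (rewrite plus_INR; lra).
assert (Hs : 0 < s) by (apply Rdiv_lt_0_compat; lra).
assert (Hz : forall z (k : nat), 0 <= z -> z ^ k <= exp (INR k * (z - 1))).
{ intros z k Hz. induction k as [|k IH]; [simpl; rewrite Rmult_0_l, exp_0; lra|].
  rewrite S_INR, Rmult_plus_distr_r, Rmult_1_l, exp_plus, <- tech_pow_Rmult.
  rewrite (Rmult_comm z).
  pose proof (exp_ineq1_le (z - 1)).
  apply Rmult_le_compat; auto using pow_le; lra. }
assert (Hps : 0 < INR p * s) by (apply Rmult_lt_0_compat; lra).
assert (Hqs : 0 < INR q * s) by (apply Rmult_lt_0_compat; lra).
assert (Hup : 0 <= u / (INR p * s)) by (apply Rle_mult_inv_pos; lra).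
assert (Hvq : 0 <= v / (INR q * s)) by (apply Rle_mult_inv_pos; lra).
assert (K : (u / (INR p * s)) ^ p * (v / (INR q * s)) ^ q <= 1).
{ rewrite <- exp_0.
  replace 0 with (INR p * (u / (INR p * s) - 1) + INR q * (v / (INR q * s) - 1)).
  - rewrite exp_plus. apply Rmult_le_compat; auto using pow_le.
  - unfold s. rewrite plus_INR. rewrite plus_INR in Hpq. field; repeat split; lra. }
replace (u ^ p * v ^ q * INR (p + q) ^ (p + q)) with
  ((u / (INR p * s)) ^ p * (v / (INR q * s)) ^ q *
   (INR p ^ p * INR q ^ q * (u + v) ^ (p + q))).
- rewrite <- (Rmult_1_l (_ * _ * (u + v) ^ _)) at 2. apply Rmult_le_compat_r; [|exact K].
  apply Rmult_le_pos; [apply Rmult_le_pos|]; apply pow_le; lra.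
- assert (D : forall x y k, y <> 0 -> (x / y) ^ k = x ^ k / y ^ k).
  { intros x y k Hy. unfold Rdiv. rewrite Rpow_mult_distr, pow_inv; auto. }
  rewrite !D by lra. rewrite !Rpow_mult_distr.
  replace (u + v) with (INR (p + q) * s) by (unfold s; field; lra).
  rewrite Rpow_mult_distr, (pow_add s).
  field; repeat split; apply pow_nonzero; lra.
Qed.

(** * Moments of the kernel 1/(x+t) *)

Definition moment (t : R) (e p : nat) : R := RInt (fun x => x ^ e / (x + t) ^ p) 0 1.

Lemma ex_RInt_derivable (f : R -> R) (a b : R) :
  (forall x, Rmin a b <= x <= Rmax a b -> ex_derive f x) -> ex_RInt f a b.
Proof.
intros H. apply (ex_RInt_continuous (V := R_CompleteNormedModule)).
intros x Hx. apply (ex_derive_continuous (K := R_AbsRing) (V := R_NormedModule)); auto.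
Qed.

Lemma is_RInt_inj (f : R -> R) (a b l l' : R) :
  is_RInt f a b l -> is_RInt f a b l' -> l = l'.
Proof.
intros H H'. rewrite <- (is_RInt_unique (V := R_CompleteNormedModule) _ _ _ _ H).
exact (is_RInt_unique (V := R_CompleteNormedModule) _ _ _ _ H').
Qed.

Lemma is_RInt_moment t e p : 0 < t ->
  is_RInt (fun x => x ^ e / (x + t) ^ p) 0 1 (moment t e p).
Proof.
intros Ht. apply (RInt_correct (V := R_CompleteNormedModule)), ex_RInt_derivable.
intros x. rewrite Rmin_left, Rmax_right by lra. intros Hx.
auto_derive. apply pow_nonzero; lra.
Qed.

(** Integrates the derivative of x^(e+1) / (x+t)^(p+1). The boundary term at 0 vanishes because the
    exponent of x is positive. *)
Lemma moment_by_parts t e p : 0 < t ->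
  INR (S p) * moment t (S e) (S (S p)) =
  INR (S e) * moment t e (S p) - / (1 + t) ^ S p.
Proof.
intros Ht.
assert (H : is_RInt (fun x => INR (S e) * (x ^ e / (x + t) ^ S p)
   - INR (S p) * (x ^ S e / (x + t) ^ S (S p))) 0 1
   (minus (1 ^ S e / (1 + t) ^ S p) (0 ^ S e / (0 + t) ^ S p))).
{ apply (is_RInt_derive (V := R_CompleteNormedModule) (fun x => x ^ S e / (x + t) ^ S p)).
  - intros x. rewrite Rmin_left, Rmax_right by lra. intros Hx.
    assert (P : forall k, (x + t) ^ k <> 0) by (intros k; apply pow_nonzero; lra).
    auto_derive; [exact (P (S p))|].
    change (pred (S e)) with e; change (pred (S p)) with p.
    rewrite <- !tech_pow_Rmult.
    change (match p with O => 1 | S _ => INR p + 1 end) with (INR (S p)).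
    change (match e with O => 1 | S _ => INR e + 1 end) with (INR (S e)).
    field; split; auto; lra.
  - intros x. rewrite Rmin_left, Rmax_right by lra. intros Hx.
    assert (P : forall k, (x + t) ^ k <> 0) by (intros k; apply pow_nonzero; lra).
    apply (ex_derive_continuous (K := R_AbsRing) (V := R_NormedModule)).
    auto_derive. exact (conj (P (S p)) (conj (P (S (S p))) I)). }
pose proof (is_RInt_minus _ _ _ _ _ _
  (is_RInt_scal _ _ _ (INR (S e)) _ (is_RInt_moment t e (S p) Ht))
  (is_RInt_scal _ _ _ (INR (S p)) _ (is_RInt_moment t (S e) (S (S p)) Ht))) as H2.
pose proof (is_RInt_inj _ _ _ _ _ H2 H) as E.
unfold minus, plus, opp, scal in E; simpl in E; unfold mult in E; simpl in E.
rewrite pow1, Rmult_0_l in E. unfold Rdiv in E. rewrite Rmult_0_l in E.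
change (match p with O => 1 | S _ => INR p + 1 end) with (INR (S p)) in E.
change (match e with O => 1 | S _ => INR e + 1 end) with (INR (S e)) in E.
change ((1 + t) ^ S p) with ((1 + t) * (1 + t) ^ p). lra.
Qed.

Lemma is_RInt_pow_unit k : is_RInt (fun x => x ^ k) 0 1 (/ INR (S k)).
Proof.
replace (/ INR (S k)) with (1 ^ S k / INR (S k) - 0 ^ S k / INR (S k)); [apply is_RInt_pow|].
pose proof (not_0_INR (S k) ltac:(lia)). rewrite pow1. change (0 ^ S k) with (0 * 0 ^ k).
field; auto.
Qed.

(** From x / (x+t) = 1 - t / (x+t). *)
Lemma moment_succ t e : 0 < t ->
  moment t (S e) 1 = / INR (S e) - t * moment t e 1.
Proof.
intros Ht.
pose proof (is_RInt_minus _ _ _ _ _ _ (is_RInt_pow_unit e)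
  (is_RInt_scal _ _ _ t _ (is_RInt_moment t e 1 Ht))) as H2.
apply is_RInt_unique. eapply is_RInt_ext; [| eapply eq_rect; [exact H2|]].
- intros x. rewrite Rmin_left, Rmax_right by lra. intros Hx.
  unfold minus, plus, opp, scal; simpl; unfold mult; simpl. field; lra.
- reflexivity.
Qed.

(* The boundary terms at [1] of the [N]-fold integration by parts form a polynomial of
   degree [< N] in [k], which [alternating_sum_poly_seq] kills. *)
Lemma moment_lower_power r t N : 0 < t -> forall E, (N <= E)%nat ->
  exists q, poly_seq N 0 q /\ forall k,
    moment t (r * k + E) (S N) =
    Binomial.C (r * k + E) N * moment t (r * k + E - N) 1 + q k.
Proof.
intros Ht. induction N as [|N IH]; intros E HE.
- exists (fun _ => 0); split; [now intros k|]. intros k. unfold Binomial.C.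
  rewrite Nat.sub_0_r. change (fact 0) with 1%nat; simpl INR.
  field; apply INR_fact_neq_0.
- destruct E as [|E]; [lia|]. destruct (IH E ltac:(lia)) as (q & Hq & Hk).
  exists (fun k => (INR r / INR (S N) * INR k + INR (S E) / INR (S N)) * q k +
     - / (1 + t) ^ S N / INR (S N)). split.
  + rewrite <- (Rplus_0_r 0) at 1. apply poly_seq_plus.
    * rewrite <- (Rmult_0_r (INR r / INR (S N))). now apply poly_seq_mul_affine.
    * apply poly_seq_const.
  + intros k. pose proof (not_0_INR (S N) ltac:(lia)) as HN.
    replace (r * k + S E)%nat with (S (r * k + E)) by lia.
    apply (Rmult_eq_reg_l (INR (S N))); auto.
    rewrite moment_by_parts, Hk, C_succ_succ by (auto; lia).
    replace (S (r * k + E) - S N)%nat with (r * k + E - N)%nat by lia.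
    rewrite (S_INR (_ + _)), (S_INR E), plus_INR, mult_INR.
    assert ((1 + t) ^ S N <> 0) by (apply pow_nonzero; lra).
    field; auto.
Qed.

(** Each use of [moment_succ] extracts a factor [- t] and leaves a binomial coefficient divided by
    [r k + E - (N - m - 1)]. As [m < N] at that point, this divisor is a factor of the binomial
    coefficient, and the remainder has degree below [N] by [poly_seq_C_div]. *)
Lemma moment_lower_exponent r t N E : 0 < t -> (N <= E)%nat -> forall m, (m <= N)%nat ->
  exists q, poly_seq N 0 q /\ forall k,
    Binomial.C (r * k + E) N * moment t (r * k + E - N + m) 1 =
    (- t) ^ m * (Binomial.C (r * k + E) N * moment t (r * k + E - N) 1) + q k.
Proof.
intros Ht HE. induction m as [|m IH]; intros Hm.
- exists (fun _ => 0). split.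
  + replace 0 with (0 * (INR r ^ N / INR (fact N))) by ring.
    eapply poly_seq_ext; [|exact (poly_seq_scal _ 0 _ _ (poly_seq_C r N E HE))].
    intros k; simpl; ring.
  + intros k. rewrite Nat.add_0_r. simpl; ring.
- destruct (IH ltac:(lia)) as (q & Hq & Hk).
  exists (fun k => Binomial.C (r * k + E) N / INR (r * k + E - (N - m - 1)) + - t * q k). split.
  + replace 0 with (0 + - t * 0) by ring. apply poly_seq_plus.
    * apply poly_seq_C_div; lia.
    * now apply poly_seq_scal.
  + intros k. rewrite Nat.add_succ_r, moment_succ by auto.
    rewrite Rmult_minus_distr_l.
    replace (S (r * k + E - N + m)) with (r * k + E - (N - m - 1))%nat by lia.
    replace (Binomial.C (r * k + E) N * (t * moment t (r * k + E - N + m) 1))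
      with (t * (Binomial.C (r * k + E) N * moment t (r * k + E - N + m) 1)) by ring.
    rewrite Hk. simpl pow. unfold Rdiv. ring.
Qed.

Lemma is_RInt_sum_f_R0 (f : nat -> R -> R) (l : nat -> R) a b N :
  (forall k, is_RInt (f k) a b (l k)) ->
  is_RInt (fun x => sum_f_R0 (fun k => f k x) N) a b (sum_f_R0 l N).
Proof.
intros H. induction N as [|N IH]; simpl; auto.
apply (is_RInt_plus (V := R_NormedModule) (fun x => sum_f_R0 (fun k => f k x) N) (f (S N))); auto.
Qed.

(** The binomial expansion of [(1 - x ^ r) ^ N]. The prefactor [(-1) ^ N] corrects the sign
    [(-1) ^ (k + N)] to [(-1) ^ k]. *)
Lemma is_RInt_alternating_moment r t N E : 0 < t ->
  is_RInt (fun x => x ^ E * (1 - x ^ r) ^ N / (x + t) ^ S N) 0 1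
    ((-1) ^ N * sum_f_R0 (fun k => (-1) ^ (k + N) * Binomial.C N k * moment t (r * k + E) (S N)) N).
Proof.
intros Ht.
pose proof (is_RInt_sum_f_R0 _ _ 0 1 N (fun k => is_RInt_scal _ _ _ ((-1) ^ (k + N) * Binomial.C N k) _
  (is_RInt_moment t (r * k + E) (S N) Ht))) as H.
pose proof (is_RInt_scal _ _ _ ((-1) ^ N) _ H) as H2.
eapply is_RInt_ext; [| exact H2].
intros x. rewrite Rmin_left, Rmax_right by lra. intros Hx.
unfold scal; simpl; unfold mult; simpl.
replace (1 - x ^ r) with (- x ^ r + 1) by ring. rewrite (binomial (- x ^ r) 1 N).
unfold Rdiv.
rewrite (Rmult_comm (x ^ E)), Rmult_assoc, (Rmult_comm (sum_f_R0 _ N)), !scal_sum.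
apply sum_eq. intros k Hk. rewrite pow1, !pow_add, pow_mult.
replace (- x ^ r) with (-1 * x ^ r) by ring. rewrite Rpow_mult_distr.
assert (S2 : (-1) ^ N * (-1) ^ N = 1).
{ rewrite <- Rpow_mult_distr. replace (-1 * -1) with 1 by ring. apply pow1. }
transitivity ((-1) ^ N * (-1) ^ N *
  (Binomial.C N k * (-1) ^ k * (x ^ r) ^ k * x ^ E * / ((x + t) * (x + t) ^ N))); [ring | rewrite S2; ring].
Qed.

(** Both sides are compared with the sum for the exponents [r k + E - N]. The two remainders are
    polynomials of degree below [N] in [k], so the alternating sum annihilates them. *)
Lemma alternating_sum_moment r t N E m : 0 < t -> (N <= E)%nat -> (m <= N)%nat ->
  sum_f_R0 (fun k => (-1) ^ (k + N) * Binomial.C N k *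
     (Binomial.C (r * k + E) N * moment t (r * k + E - N + m) 1)) N =
  (- t) ^ m * sum_f_R0 (fun k => (-1) ^ (k + N) * Binomial.C N k * moment t (r * k + E) (S N)) N.
Proof.
intros Ht HE Hm.
destruct (moment_lower_power r t N Ht E HE) as (q1 & Hq1 & H1).
destruct (moment_lower_exponent r t N E Ht HE m Hm) as (q2 & Hq2 & H2).
pose proof (alternating_sum_poly_seq _ _ _
  (poly_seq_plus _ _ _ _ _ Hq2 (poly_seq_scal _ (- (- t) ^ m) _ _ Hq1))) as Z.
rewrite Rmult_0_r, Rplus_0_r, Rmult_0_r in Z. cbv beta in Z.
rewrite scal_sum. rewrite <- Rplus_0_r, <- Z, <- sum_plus. apply sum_eq. intros k _.
rewrite H1, H2. ring.
Qed.

(** * The bound for one kernel *)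

(** Only the exponents involving [b / r] need real powers, and their bases are positive once [b] is.
    The other factors use [pow], for which 0^0 = 1. *)
Definition rate (a b c r : nat) : R :=
  Rpower (INR b) (INR b / INR r) *
  INR (c + a - b) ^ (c + a - b) *
  INR (b - a) ^ (b - a) /
  Rpower (INR (b + c * r)) (INR c + INR b / INR r).

Lemma pow_self_pos k : 0 < INR k ^ k.
Proof.
destruct k as [|k]; [simpl; lra|]. apply pow_lt, lt_0_INR; lia.
Qed.

Lemma pow_le_reg (x y : R) (r : nat) : (1 <= r)%nat -> 0 <= y -> x ^ r <= y ^ r -> x <= y.
Proof.
intros Hr Hy H. destruct (Rle_lt_dec x y) as [|L]; auto. exfalso.
destruct r as [|r]; [lia|].
assert (y ^ r <= x ^ r) by (apply pow_incr; lra).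
assert (0 < x ^ r) by (apply pow_lt; lra).
rewrite <- !tech_pow_Rmult in H.
assert (y * y ^ r <= y * x ^ r) by (apply Rmult_le_compat_l; lra).
assert (y * x ^ r < x * x ^ r) by (apply Rmult_lt_compat_r; lra). lra.
Qed.

Lemma Rpower_pow_r (z y : R) (r : nat) : Rpower z y ^ r = Rpower z (y * INR r).
Proof. rewrite <- Rpower_mult, Rpower_pow; [reflexivity | apply exp_pos]. Qed.

(** Raising to the power [r] clears the exponents [b / r]. What remains is [pow_mul_pow_le] with
    exponents [b] and [c r] at [u = x ^ r] and [v = 1 - x ^ r], whose sum is 1. *)
Lemma pow_one_sub_pow_le (b c r : nat) (x : R) : (1 <= b)%nat -> (1 <= r)%nat -> 0 <= x <= 1 ->
  x ^ b * (1 - x ^ r) ^ c <=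
  Rpower (INR b) (INR b / INR r) * INR (c * r) ^ c / Rpower (INR (b + c * r)) (INR c + INR b / INR r).
Proof.
intros Hb Hr Hx.
assert (Hr' : INR r <> 0) by (apply not_0_INR; lia).
assert (Hxr : 0 <= x ^ r <= 1).
{ split; [apply pow_le; lra|]. rewrite <- (pow1 r). apply pow_incr; lra. }
apply (pow_le_reg _ _ r Hr).
{ apply Rle_mult_inv_pos; [|apply exp_pos].
  apply Rmult_le_pos; [left; apply exp_pos | apply pow_le, pos_INR]. }
assert (D : 0 < INR (b + c * r) ^ (b + c * r)) by apply pow_self_pos.
unfold Rdiv at 1. rewrite !Rpow_mult_distr, pow_inv, !Rpower_pow_r, <- !pow_mult.
replace (INR b / INR r * INR r) with (INR b) by (field; auto).
replace ((INR c + INR b / INR r) * INR r) with (INR (b + c * r))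
  by (rewrite plus_INR, mult_INR; field; auto).
rewrite !Rpower_pow by (apply lt_0_INR; lia).
apply (Rmult_le_reg_r (INR (b + c * r) ^ (b + c * r))); auto.
rewrite Rmult_assoc, (Rmult_assoc _ (/ _)), Rinv_l, Rmult_1_r by lra.
pose proof (pow_mul_pow_le b (c * r) (x ^ r) (1 - x ^ r) ltac:(lra) ltac:(lra)) as K.
replace (x ^ r + (1 - x ^ r)) with 1 in K by ring. rewrite pow1, Rmult_1_r in K.
rewrite <- pow_mult, (Nat.mul_comm r b) in K. rewrite Rmult_assoc in K. exact K.
Qed.

(** Splitting [a + c] as [(c + a - b) + b] separates the two uses of AM-GM. The factor c^c of the
    first one cancels against (c r)^c = c^c r^c in the second, leaving [INR r ^ c]. *)
Lemma kernel_le (a b c r : nat) (x t : R) : (1 <= b)%nat -> (1 <= r)%nat ->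
  (a <= b)%nat -> (b - a <= c)%nat -> 0 <= x <= 1 -> 0 < t ->
  t ^ (b - a) * x ^ (a + c) * (1 - x ^ r) ^ c <= rate a b c r * INR r ^ c * (x + t) ^ c.
Proof.
intros Hb Hr Hab Habc Hx Ht.
pose proof (pow_mul_pow_le (b - a) (c + a - b) t x ltac:(lra) ltac:(lra)) as K1.
pose proof (pow_one_sub_pow_le b c r x Hb Hr Hx) as K2.
replace (b - a + (c + a - b))%nat with c in K1 by lia.
set (P := INR (b - a) ^ (b - a)) in *. set (Q := INR (c + a - b) ^ (c + a - b)) in *.
replace (a + c)%nat with ((c + a - b) + b)%nat by lia.
assert (Hc0 : 0 < INR c ^ c) by apply pow_self_pos.
apply (Rmult_le_reg_r (INR c ^ c)); auto.
assert (Hxr : 0 <= x ^ r <= 1).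
{ split; [apply pow_le; lra|]. rewrite <- (pow1 r). apply pow_incr; lra. }
replace (t ^ (b - a) * x ^ (c + a - b + b) * (1 - x ^ r) ^ c * INR c ^ c) with
 ((t ^ (b - a) * x ^ (c + a - b) * INR c ^ c) * (x ^ b * (1 - x ^ r) ^ c)) by (rewrite pow_add; ring).
eapply Rle_trans.
- apply Rmult_le_compat; [ | | exact K1 | exact K2].
  + apply Rmult_le_pos; [apply Rmult_le_pos|]; try lra; apply pow_le; lra.
  + apply Rmult_le_pos; apply pow_le; lra.
- right. unfold rate, P, Q. rewrite mult_INR, Rpow_mult_distr, (Rplus_comm t x).
  field. apply Rgt_not_eq, exp_pos.
Qed.

Definition functional (a b c r n : nat) (u : nat -> R) : R :=
  / INR r ^ (c * n) *
  sum_f_R0 (fun k => (-1) ^ (k + c * n) * Binomial.C (c * n) k *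
     Binomial.C (r * k + (a + c) * n) (c * n) * u (r * k + b * n)%nat) (c * n).

Lemma functional_moment_le (a b c r n : nat) (t : R) :
  (1 <= b)%nat -> (1 <= r)%nat ->
  (a <= b)%nat -> (b - a <= c)%nat -> 0 < t ->
  Rabs (functional a b c r n (fun e => moment t e 1)) <= rate a b c r ^ n * moment t 0 1.
Proof.
intros Hb Hr Hab Habc Ht.
assert (Hr0 : 0 < INR r) by (apply lt_0_INR; lia).
assert (HrN : 0 < INR r ^ (c * n)) by (apply pow_lt; lra).
assert (HN : (c * n <= (a + c) * n)%nat) by nia.
assert (Hm : ((b - a) * n <= c * n)%nat) by nia.
pose proof (alternating_sum_moment r t _ _ _ Ht HN Hm) as H.
pose proof (is_RInt_alternating_moment r t (c * n) ((a + c) * n) Ht) as I.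
set (A := sum_f_R0 (fun k => (-1) ^ (k + c * n) * Binomial.C (c * n) k *
  moment t (r * k + (a + c) * n) (S (c * n))) (c * n)) in *.
(* With [N = c n], [E = (a + c) n] and [m = (b - a) n], the exponent [r k + E - N + m] is exactly
   [r k + b n]. *)
assert (F : functional a b c r n (fun e => moment t e 1) =
  / INR r ^ (c * n) * ((- t) ^ ((b - a) * n) * A)).
{ unfold functional. f_equal. rewrite <- H. apply sum_eq. intros k _.
  rewrite Rmult_assoc. f_equal. f_equal. f_equal. nia. }
(* The integrand is nonnegative on [0, 1], so the sign of [A] is known and its absolute value is the
   integral itself. *)
assert (B : Rabs A = (-1) ^ (c * n) * A).
{ assert (0 <= (-1) ^ (c * n) * A).
  { apply (is_RInt_ge_0 _ _ _ _ Rle_0_1 I). intros x Hx.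
    apply Rle_mult_inv_pos; [|apply pow_lt; lra].
    apply Rmult_le_pos; apply pow_le; [lra|].
    assert (x ^ r <= 1 ^ r) by (apply pow_incr; lra). rewrite pow1 in *; lra. }
  rewrite <- (Rabs_pos_eq _ H0), Rabs_mult, pow_1_abs. ring. }
rewrite F, !Rabs_mult, B, <- RPow_abs, Rabs_Ropp, (Rabs_pos_eq t) by lra.
rewrite Rabs_pos_eq by (left; now apply Rinv_0_lt_compat).
pose proof (is_RInt_scal _ _ _ (/ INR r ^ (c * n) * t ^ ((b - a) * n)) _ I) as I1.
pose proof (is_RInt_scal _ _ _ (rate a b c r ^ n) _ (is_RInt_moment t 0 1 Ht)) as I2.
rewrite <- Rmult_assoc.
refine (is_RInt_le _ _ _ _ _ _ Rle_0_1 I1 I2 _).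
intros x Hx. unfold scal; simpl; unfold mult; simpl. rewrite Rmult_1_r.
pose proof (kernel_le a b c r x t Hb Hr Hab Habc ltac:(lra) Ht) as K.
assert (x ^ r <= 1 ^ r) by (apply pow_incr; lra). rewrite pow1 in *.
assert (K0 : 0 <= t ^ (b - a) * x ^ (a + c) * (1 - x ^ r) ^ c)
  by (apply Rmult_le_pos; [apply Rmult_le_pos|]; apply pow_le; lra).
apply (fun K => pow_incr _ _ n (conj K0 K)) in K.
rewrite !Rpow_mult_distr, <- !pow_mult in K.
assert (X : 0 < (x + t) ^ (c * n)) by (apply pow_lt; lra).
apply (Rmult_le_reg_r ((x + t) ^ (c * n) * (x + t) * INR r ^ (c * n))).
{ apply Rmult_lt_0_compat; [apply Rmult_lt_0_compat|]; lra. }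
match goal with |- ?l <= ?r0 =>
 replace l with (t ^ ((b - a) * n) * x ^ ((a + c) * n) * (1 - x ^ r) ^ (c * n)) by (field; repeat split; lra);
 replace r0 with (rate a b c r ^ n * INR r ^ (c * n) * (x + t) ^ (c * n)) by (field; lra) end.
exact K.
Qed.

(** * Positive sums of kernels *)

Definition stieltjes (l : list (R * R)) (x : R) : R :=
  fold_right (fun p acc => fst p / (x + snd p) + acc) 0 l.

(** The pairs are (weight, t) for the kernels weight / (x+t). The explicit lower bound [tau] allows
    [stieltjes_mul] to put a new pole strictly on one side of all earlier ones. *)
Definition admissible (tau : R) (l : list (R * R)) : Prop :=
  Forall (fun p => 0 <= fst p /\ tau <= snd p) l.

Definition rescale (c : R) (l : list (R * R)) : list (R * R) :=
  map (fun p => (c * fst p, snd p)) l.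

Lemma stieltjes_rescale c l x : stieltjes (rescale c l) x = c * stieltjes l x.
Proof.
induction l as [|p l IH]; simpl; [ring|]. rewrite IH. unfold Rdiv; ring.
Qed.

Lemma admissible_rescale tau c l : 0 <= c -> admissible tau l -> admissible tau (rescale c l).
Proof.
intros Hc H. induction H as [|p l [H1 H2] _ IH]; constructor; auto.
simpl; split; auto. now apply Rmult_le_pos.
Qed.

Lemma stieltjes_app l l' x : stieltjes (l ++ l') x = stieltjes l x + stieltjes l' x.
Proof. induction l as [|p l IH]; simpl; [ring|]. rewrite IH; ring. Qed.

(** Partial fractions: (x+b) / ((x+a)(x+t)) has coefficients (t-b)/(t-a) at t and (b-a)/(t-a) at a.
    Both are nonnegative because a <= b <= t and a < t. *)
Lemma stieltjes_mul (a b tau : R) (l : list (R * R)) :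
  0 < a < tau -> a <= b <= tau -> admissible tau l ->
  exists l', admissible a l' /\
    forall x, 0 <= x -> stieltjes l' x = (x + b) / (x + a) * stieltjes l x.
Proof.
intros Ha Hb H. induction H as [|[rho t] l [H1 H2] H (l' & A & E)].
- exists nil. split; [constructor|]. intros x Hx; simpl; ring.
- simpl in H1, H2.
  exists ((rho * ((t - b) / (t - a)), t) :: (rho * ((b - a) / (t - a)), a) :: l'). split.
  + constructor; [|constructor; auto]; simpl; split; try lra;
      apply Rmult_le_pos, Rle_mult_inv_pos; lra.
  + intros x Hx. simpl. rewrite E by auto. field. lra.
Qed.

Lemma exp_le (x y : R) : x <= y -> exp x <= exp y.
Proof. intros [H|H]; [left; now apply exp_increasing | subst; lra]. Qed.

Lemma exp_div_add_le (x v w : R) : 0 <= x -> v <= w ->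
  exp v / (x + exp v) <= exp w / (x + exp w).
Proof.
intros Hx Hvw. pose proof (exp_pos v). pose proof (exp_pos w).
pose proof (exp_le v w Hvw).
apply Rminus_le_0.
replace (exp w / (x + exp w) - exp v / (x + exp v))
  with (x * (exp w - exp v) / ((x + exp w) * (x + exp v))) by (field; lra).
apply Rle_mult_inv_pos; nra.
Qed.

(** As a function of w, ln (x + exp w) has the nondecreasing derivative exp w / (x + exp w), and the
    mean value theorem applies. *)
Lemma ln_add_exp_bounds (x v w : R) : 0 <= x -> v <= w ->
  (w - v) * (exp v / (x + exp v)) <= ln (x + exp w) - ln (x + exp v)
    <= (w - v) * (exp w / (x + exp w)).
Proof.
intros Hx Hvw.
destruct (MVT_gen (fun y => ln (x + exp y)) v w (fun y => exp y / (x + exp y))) as (z & Hz & E).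
- intros y _. pose proof (exp_pos y). auto_derive; [lra|]. field; lra.
- intros y _. apply continuity_pt_filterlim.
  apply (ex_derive_continuous (K := R_AbsRing) (V := R_NormedModule) (fun y => ln (x + exp y))).
  pose proof (exp_pos y). auto_derive; lra.
- rewrite Rmin_left, Rmax_right in Hz by auto. rewrite E.
  rewrite (Rmult_comm (exp z / _)).
  split; apply Rmult_le_compat_l; try lra; apply exp_div_add_le; lra.
Qed.

(* The witness is the product of [n] factors [(x + b_i) / (x + a_i)] and of [1 / (x + a_n)], where
   [a_i = exp (v + i delta)] and [b_i = exp (v + (i + sigma) delta)]. *)
Lemma interlacing_product (sigma delta : R) (n : nat) : 0 <= sigma <= 1 -> 0 < delta -> forall v,
  exists l, admissible (exp v) l /\ forall x, 0 <= x -> 0 < stieltjes l x /\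
    Rabs (ln (stieltjes l x) -
      (sigma * (ln (x + exp (v + INR n * delta)) - ln (x + exp v)) - ln (x + exp (v + INR n * delta))))
    <= delta * (exp (v + INR n * delta) / (x + exp (v + INR n * delta)) - exp v / (x + exp v)).
Proof.
intros Hs Hd. induction n as [|n IH]; intros v.
- exists ((1, exp v) :: nil). split; [repeat constructor; simpl; lra|].
  intros x Hx. pose proof (exp_pos v). simpl. rewrite Rmult_0_l, !Rplus_0_r.
  split; [apply Rdiv_lt_0_compat; lra|].
  unfold Rdiv at 1. rewrite Rmult_1_l, ln_Rinv by lra.
  match goal with |- Rabs ?y <= _ => replace y with 0 by ring end. rewrite Rabs_R0; lra.
- destruct (IH (v + delta)) as (l & A & B).
  assert (M1 : exp v < exp (v + delta)) by (apply exp_increasing; lra).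
  assert (Hsd : 0 <= sigma * delta <= delta) by (split; nra).
  assert (M2 : exp v <= exp (v + sigma * delta) <= exp (v + delta)) by (split; apply exp_le; lra).
  pose proof (exp_pos v) as Ev.
  destruct (stieltjes_mul (exp v) (exp (v + sigma * delta)) (exp (v + delta)) l) as (l' & A' & E); auto.
  exists l'. split; auto. intros x Hx. destruct (B x Hx) as [B1 B2].
  rewrite E by auto.
  assert (P : 0 < (x + exp (v + sigma * delta)) / (x + exp v)) by (apply Rdiv_lt_0_compat; lra).
  split; [now apply Rmult_lt_0_compat|].
  rewrite ln_mult, ln_div by lra.
  replace (v + INR (S n) * delta) with (v + delta + INR n * delta) by (rewrite S_INR; ring).
  pose proof (ln_add_exp_bounds x v (v + sigma * delta) Hx ltac:(lra)) as C1.
  pose proof (ln_add_exp_bounds x v (v + delta) Hx ltac:(lra)) as C2.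
  pose proof (ln_add_exp_bounds x (v + sigma * delta) (v + delta) Hx ltac:(lra)) as C3.
  set (V := v + delta + INR n * delta) in *.
  set (W := v + sigma * delta) in *.
  replace (W - v) with (sigma * delta) in C1 by (unfold W; ring).
  replace (v + delta - v) with delta in C2 by ring.
  replace (v + delta - W) with ((1 - sigma) * delta) in C3 by (unfold W; ring).
  set (g0 := exp v / (x + exp v)) in *. set (g1 := exp (v + delta) / (x + exp (v + delta))) in *.
  set (gW := exp W / (x + exp W)) in *. set (gV := exp V / (x + exp V)) in *.
  set (p0 := ln (x + exp v)) in *. set (p1 := ln (x + exp (v + delta))) in *.
  set (pW := ln (x + exp W)) in *. set (pV := ln (x + exp V)) in *.
  set (L := ln (stieltjes l x)) in *.
  (* The error of one factor: convexity bounds the distance between the increment up to [W] and the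
     fraction [sigma] of the whole increment. The bounds [delta (g1 - g0)] telescope over the
     factors. *)
  assert (Z : Rabs ((pW - p0) - sigma * (p1 - p0)) <= delta * (g1 - g0)).
  { apply Rabs_le.
    pose proof (exp_div_add_le x v (v + delta) Hx ltac:(lra)) as G1. fold g0 g1 in G1.
    pose proof (exp_div_add_le x W (v + delta) Hx ltac:(unfold W; lra)) as G2. fold gW g1 in G2.
    assert (sigma * delta * gW <= sigma * delta * g1) by (apply Rmult_le_compat_l; lra).
    assert (sigma * (delta * g0) <= sigma * (p1 - p0) <= sigma * (delta * g1))
      by (split; apply Rmult_le_compat_l; lra).
    assert (sigma * (delta * (g1 - g0)) <= 1 * (delta * (g1 - g0)))
      by (apply Rmult_le_compat_r; [apply Rmult_le_pos|]; lra).
    split; lra. }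
  replace (pW - p0 + L - (sigma * (pV - p0) - pV)) with
    ((L - (sigma * (pV - p1) - pV)) + ((pW - p0) - sigma * (p1 - p0))) by ring.
  eapply Rle_trans; [apply Rabs_triang|]. lra.
Qed.

Lemma ln_le_sub_one (y : R) : 0 < y -> ln y <= y - 1.
Proof.
intros Hy. rewrite <- (ln_exp (y - 1)). apply ln_le; [exact Hy|].
pose proof (exp_ineq1_le (y - 1)); lra.
Qed.

Lemma exp_dist_le (x y : R) : x <= 0 -> y <= 0 -> Rabs (exp x - exp y) <= Rabs (x - y).
Proof.
revert x y. assert (H : forall x y, x <= y -> y <= 0 -> exp y - exp x <= y - x).
{ intros x y Hxy Hy. pose proof (exp_ineq1_le (x - y)) as E.
  pose proof (exp_pos y). pose proof (exp_le y 0 Hy) as L. rewrite exp_0 in L.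
  replace (exp x) with (exp y * exp (x - y)) by (rewrite <- exp_plus; f_equal; ring).
  nra. }
intros x y Hx Hy. destruct (Rle_lt_dec x y) as [L|L].
- pose proof (exp_le _ _ L). rewrite !Rabs_left1 by lra. pose proof (H x y L Hy); lra.
- pose proof (exp_le y x ltac:(lra)). rewrite !Rabs_pos_eq by lra. pose proof (H y x ltac:(lra) Hx); lra.
Qed.

(** Each x / (x+t) is nondecreasing in x. *)
Lemma mul_stieltjes_le tau l x : 0 < tau -> admissible tau l -> 0 <= x <= 1 ->
  0 <= x * stieltjes l x <= stieltjes l 1.
Proof.
intros Ht H Hx. induction H as [|[rho t] l [H1 H2] _ IH]; simpl in *; [lra|].
assert (0 <= x * (rho / (x + t)) <= rho / (1 + t)).
{ split; [apply Rmult_le_pos; [lra|apply Rle_mult_inv_pos; lra]|].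
  apply Rminus_le_0.
  replace (rho / (1 + t) - x * (rho / (x + t)))
    with (rho * t * (1 - x) / ((1 + t) * (x + t))) by (field; lra).
  apply Rle_mult_inv_pos; [|nra]. apply Rmult_le_pos; [apply Rmult_le_pos|]; lra. }
lra.
Qed.

(** The product of [interlacing_product] is close to (x + beta)^(sigma-1) (x + alpha)^(-sigma).
    Normalised at x = 1, with alpha small and beta large, it is close to x^(-sigma). It suffices to
    compare logarithms, since both quantities are at most 1 and exp is 1-Lipschitz there. *)
Lemma stieltjes_approx_Rpower (sigma eta kappa : R) : 0 <= sigma <= 1 -> 0 < eta < 1 -> 0 < kappa ->
  exists tau l, 0 < tau /\ admissible tau l /\ stieltjes l 1 = 1 /\
    forall x, eta <= x <= 1 -> Rabs (x * stieltjes l x - Rpower x (1 - sigma)) <= kappa.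
Proof.
intros Hs He Hk.
(* This makes [alpha / x <= kappa / 4] for all [x >= eta]; the number of factors [n] is then chosen
   so that [beta >= 4 / kappa]. *)
set (alpha := eta * (kappa / 4)). assert (Ha : 0 < alpha) by (unfold alpha; nra).
set (v := ln alpha).
destruct (INR_unbounded ((ln (4 / kappa) - v) / (kappa / 4))) as [n Hn].
assert (Hn' : ln (4 / kappa) <= v + INR n * (kappa / 4)).
{ apply Rgt_lt, (Rmult_lt_compat_r (kappa / 4)) in Hn; [|lra].
  unfold Rdiv in Hn at 1. rewrite Rmult_assoc, Rinv_l in Hn by lra. lra. }
apply exp_le in Hn'. rewrite exp_ln in Hn' by (apply Rdiv_lt_0_compat; lra).
destruct (interlacing_product sigma (kappa / 4) n Hs ltac:(lra) v) as (l & A & B).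
set (beta := exp (v + INR n * (kappa / 4))) in *.
replace (exp v) with alpha in * by (unfold v; rewrite exp_ln; auto).
assert (Hb : / beta <= kappa / 4).
{ replace (kappa / 4) with (/ (4 / kappa)) by (field; lra). apply Rinv_le_contravar; auto.
  apply Rdiv_lt_0_compat; lra. }
assert (Hbp : 0 < beta) by apply exp_pos.
destruct (B 1 ltac:(lra)) as [P1 Q1].
exists alpha, (rescale (/ stieltjes l 1) l).
assert (A' : admissible alpha (rescale (/ stieltjes l 1) l)).
{ apply admissible_rescale; auto. left. now apply Rinv_0_lt_compat. }
assert (E1 : stieltjes (rescale (/ stieltjes l 1) l) 1 = 1).
{ rewrite stieltjes_rescale. field; lra. }
repeat (split; auto).
intros x Hx. destruct (B x ltac:(lra)) as [Px Qx].
assert (F : forall y, 0 < y <= 1 -> beta / (y + beta) <= 1 /\ 0 <= alpha / (y + alpha)).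
{ intros y Hy. split; [apply Rle_div_l; lra | apply Rle_mult_inv_pos; lra]. }
assert (Fx := F x ltac:(lra)). assert (F1 := F 1 ltac:(lra)). clear F.
assert (G1 : 0 <= ln (1 + beta) - ln (x + beta) <= / beta).
{ split; [apply Rle_minus_r; rewrite Rplus_0_l; apply ln_le; lra|].
  rewrite <- ln_div by lra.
  pose proof (ln_le_sub_one ((1 + beta) / (x + beta)) ltac:(apply Rdiv_lt_0_compat; lra)) as L.
  eapply Rle_trans; [exact L|].
  replace ((1 + beta) / (x + beta) - 1) with ((1 - x) / (x + beta)) by (field; lra).
  apply Rle_div_l; [lra|]. rewrite Rmult_plus_distr_l, Rinv_l by lra.
  assert (0 <= / beta * x) by (apply Rmult_le_pos; [left; now apply Rinv_0_lt_compat | lra]). lra. }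
assert (G2 : 0 <= ln (x + alpha) - ln (1 + alpha) - ln x <= kappa / 4).
{ split.
  - assert (ln (x * (1 + alpha)) <= ln (x + alpha)) by (apply ln_le; nra).
    rewrite ln_mult in H by lra. lra.
  - assert (0 <= ln (1 + alpha)) by (rewrite <- ln_1; apply ln_le; lra).
    pose proof (ln_le_sub_one ((x + alpha) / x) ltac:(apply Rdiv_lt_0_compat; lra)) as L.
    rewrite ln_div in L by lra.
    replace ((x + alpha) / x - 1) with (alpha / x) in L by (field; lra).
    assert (alpha / x <= kappa / 4).
    { apply Rle_div_l; [lra|]. unfold alpha. rewrite Rmult_comm. apply Rmult_le_compat_l; lra. }
    lra. }
set (F := / stieltjes l 1 * stieltjes l x).
assert (HF : 0 < F) by (apply Rmult_lt_0_compat; auto; now apply Rinv_0_lt_compat).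
assert (LF : ln F = ln (stieltjes l x) - ln (stieltjes l 1)).
{ unfold F. rewrite ln_mult, ln_Rinv; auto using Rinv_0_lt_compat. ring. }
(* Four errors of at most [kappa / 4] each: the product formula at [x] and at 1, the replacement of
   [beta] by infinity, and that of [alpha] by 0. *)
assert (K : Rabs (ln (x * F) - (1 - sigma) * ln x) <= kappa).
{ rewrite ln_mult, LF by lra.
  apply Rabs_le_between in Q1. apply Rabs_le_between in Qx.
  set (b1 := ln (1 + beta)) in *. set (bx := ln (x + beta)) in *.
  set (a1 := ln (1 + alpha)) in *. set (ax := ln (x + alpha)) in *.
  set (s1 := ln (stieltjes l 1)) in *. set (sx := ln (stieltjes l x)) in *.
  set (lx := ln x) in *.
  assert (D1 : kappa / 4 * (beta / (1 + beta) - alpha / (1 + alpha)) <= kappa / 4 * 1)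
    by (apply Rmult_le_compat_l; lra).
  assert (Dx : kappa / 4 * (beta / (x + beta) - alpha / (x + alpha)) <= kappa / 4 * 1)
    by (apply Rmult_le_compat_l; lra).
  assert (S1 : 0 <= (1 - sigma) * (b1 - bx) <= 1 * (b1 - bx))
    by (split; [apply Rmult_le_pos | apply Rmult_le_compat_r]; lra).
  assert (S2 : 0 <= sigma * (ax - a1 - lx) <= 1 * (ax - a1 - lx))
    by (split; [apply Rmult_le_pos | apply Rmult_le_compat_r]; lra).
  apply Rabs_le. lra. }
rewrite stieltjes_rescale. fold F. unfold Rpower.
assert (XF : 0 < x * F <= 1).
{ split; [apply Rmult_lt_0_compat; lra|].
  pose proof (mul_stieltjes_le _ _ x Ha A' ltac:(lra)) as M.
  rewrite E1, stieltjes_rescale in M. exact (proj2 M). }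
rewrite <- (exp_ln (x * F)) by lra.
eapply Rle_trans; [apply exp_dist_le | exact K].
- rewrite <- ln_1. apply ln_le; lra.
- assert (ln x <= 0) by (rewrite <- ln_1; apply ln_le; lra). nra.
Qed.

(** * Approximation of the moments *)

Definition smoment (l : list (R * R)) (k : nat) : R :=
  fold_right (fun p acc => fst p * moment (snd p) k 1 + acc) 0 l.

Lemma is_RInt_smoment tau l k : 0 < tau -> admissible tau l ->
  is_RInt (fun x => x ^ k * stieltjes l x) 0 1 (smoment l k).
Proof.
intros Ht H. induction H as [|[rho t] l [H1 H2] _ IH]; simpl in *.
- eapply is_RInt_ext; [|eapply eq_rect; [exact (is_RInt_const (V := R_NormedModule) 0 1 0)|]].
  + intros; simpl; ring.
  + change ((1 - 0) * 0 = 0); ring.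
- pose proof (is_RInt_plus _ _ _ _ _ _
    (is_RInt_scal _ _ _ rho _ (is_RInt_moment t k 1 ltac:(lra))) IH) as I.
  eapply is_RInt_ext; [|exact I].
  intros x. rewrite Rmin_left, Rmax_right by lra. intros Hx.
  unfold plus, scal; simpl; unfold mult; simpl. field; lra.
Qed.

Lemma is_RInt_Rpower (eta y : R) : 0 < eta < 1 -> 0 <= y ->
  is_RInt (fun x => Rpower x y) eta 1 ((1 - Rpower eta (y + 1)) / (y + 1)).
Proof.
intros He Hy.
replace ((1 - Rpower eta (y + 1)) / (y + 1))
  with (minus (Rpower 1 (y + 1) / (y + 1)) (Rpower eta (y + 1) / (y + 1))).
- apply (is_RInt_derive (V := R_CompleteNormedModule) (fun x => Rpower x (y + 1) / (y + 1))).
  + intros x. rewrite Rmin_left, Rmax_right by lra. intros Hx.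
    unfold Rpower. auto_derive; [lra|].
    replace ((y + 1) * ln x) with (y * ln x + ln x) by ring.
    rewrite exp_plus, exp_ln by lra. field; lra.
  + intros x. rewrite Rmin_left, Rmax_right by lra. intros Hx.
    apply (ex_derive_continuous (K := R_AbsRing) (V := R_NormedModule) (fun x => Rpower x y)).
    unfold Rpower. auto_derive. lra.
- change (Rpower 1 (y + 1) / (y + 1) - Rpower eta (y + 1) / (y + 1) = (1 - Rpower eta (y + 1)) / (y + 1)).
  unfold Rpower at 1. rewrite ln_1, Rmult_0_r, exp_0. field; lra.
Qed.

Lemma is_RInt_succ_moment tau l k : 0 < tau -> admissible tau l ->
  is_RInt (fun x => x ^ k * (x * stieltjes l x)) 0 1 (smoment l (S k)).
Proof.
intros Ht H. eapply is_RInt_ext; [|exact (is_RInt_smoment tau l (S k) Ht H)].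
intros x _. simpl; ring.
Qed.

(** On [eta, 1] the integrand is within [kappa] of x^(k+s). On [0, eta] both it and x^(k+s) lie in
    [0, 1], so each contributes at most [eta]. The bound is uniform in [k]. *)
Lemma smoment_succ_near (tau s eta kappa : R) (l : list (R * R)) (k : nat) :
  0 < tau -> admissible tau l -> stieltjes l 1 = 1 -> 0 <= s -> 0 < eta < 1 -> 0 < kappa ->
  (forall x, eta <= x <= 1 -> Rabs (x * stieltjes l x - Rpower x s) <= kappa) ->
  Rabs (smoment l (S k) - / (INR (S k) + s)) <= 2 * eta + kappa.
Proof.
intros Ht A E1 Hs He Hk H.
pose proof (is_RInt_succ_moment tau l k Ht A) as I.
set (f := fun x => x ^ k * (x * stieltjes l x)) in *.
assert (X : ex_RInt f 0 1) by (eexists; exact I).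
destruct (ex_RInt_Chasles_1 f 0 eta 1 ltac:(lra) X) as [i0 I0].
destruct (ex_RInt_Chasles_2 f 0 eta 1 ltac:(lra) X) as [i1 I1].
pose proof (is_RInt_inj _ _ _ _ _ I (is_RInt_Chasles _ _ _ _ _ _ I0 I1)) as E.
change (plus i0 i1) with (i0 + i1) in E.
assert (Hpow : forall x, 0 <= x <= 1 -> 0 <= x ^ k <= 1).
{ intros x Hx. split; [apply pow_le; lra|]. rewrite <- (pow1 k). apply pow_incr; lra. }
assert (B0 : 0 <= i0 <= eta).
{ assert (Hf : forall x, 0 < x < eta -> 0 <= f x <= 1).
  { intros x Hx. pose proof (mul_stieltjes_le tau l x Ht A ltac:(lra)) as M. rewrite E1 in M.
    pose proof (Hpow x ltac:(lra)). unfold f. split; [apply Rmult_le_pos; lra|].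
    rewrite <- (Rmult_1_l 1). apply Rmult_le_compat; lra. }
  split.
  - apply (is_RInt_ge_0 f 0 eta); [lra | exact I0 |]. intros x Hx; apply Hf; auto.
  - replace eta with (scal (eta - 0) 1) by (change ((eta - 0) * 1 = eta); ring).
    refine (is_RInt_le f _ 0 eta _ _ _ I0 (is_RInt_const (V := R_NormedModule) 0 eta 1) _); [lra|].
    intros x Hx; apply Hf; auto. }
pose proof (pos_INR k) as Pk.
pose proof (is_RInt_Rpower eta (INR k + s) He ltac:(lra)) as J.
pose proof (is_RInt_minus _ _ _ _ _ _ I1 J) as D.
assert (B1 : Rabs (i1 - (1 - Rpower eta (INR k + s + 1)) / (INR k + s + 1)) <= (1 - eta) * kappa).
{ refine (norm_RInt_le_const (V := R_NormedModule) _ eta 1 _ kappa _ _ D); [lra|].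
  intros x Hx. change (Rabs (f x - Rpower x (INR k + s)) <= kappa).
  unfold f. rewrite Rpower_plus, Rpower_pow by lra.
  rewrite <- Rmult_minus_distr_l, Rabs_mult.
  pose proof (Hpow x ltac:(lra)). rewrite (Rabs_pos_eq (x ^ k)) by lra.
  rewrite <- (Rmult_1_l kappa). apply Rmult_le_compat; try lra; auto using Rabs_pos. }
assert (B2 : 0 < Rpower eta (INR k + s + 1) <= eta).
{ split; [apply exp_pos|]. rewrite <- (exp_ln eta) at 2 by lra. apply exp_le.
  assert (ln eta < 0) by (rewrite <- ln_1; apply ln_increasing; lra). nra. }
rewrite S_INR.
set (y := INR k + s) in *. replace (INR k + 1 + s) with (y + 1) by (unfold y; ring).
assert (Hy : 0 <= y) by (unfold y; lra).
assert (B3 : 0 <= Rpower eta (y + 1) / (y + 1) <= eta).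
{ split; [apply Rle_mult_inv_pos; lra|]. apply Rle_div_l; nra. }
replace ((1 - Rpower eta (y + 1)) / (y + 1))
  with (/ (y + 1) - Rpower eta (y + 1) / (y + 1)) in B1 by (field; lra).
apply Rabs_le_between in B1. rewrite E. apply Rabs_le.
assert ((1 - eta) * kappa <= kappa) by nra. lra.
Qed.

(* [(F 1 - x F x) / (1 - x)] is again a Stieltjes sum. *)
Definition divided_difference (l : list (R * R)) : list (R * R) :=
  map (fun p => (fst p * snd p / (1 + snd p), snd p)) l.

Lemma divided_difference_spec tau l x : 0 < tau -> admissible tau l -> 0 <= x ->
  (1 - x) * stieltjes (divided_difference l) x = stieltjes l 1 - x * stieltjes l x.
Proof.
intros Ht H Hx. induction H as [|[rho t] l [H1 H2] _ IH]; simpl in *; [ring|].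
rewrite Rmult_plus_distr_l, IH. field; lra.
Qed.

Lemma admissible_divided_difference tau l : 0 < tau -> admissible tau l ->
  admissible tau (divided_difference l).
Proof.
intros Ht H. induction H as [|[rho t] l [H1 H2] _ IH]; constructor; auto.
simpl in *. split; auto. apply Rle_mult_inv_pos; [apply Rmult_le_pos|]; lra.
Qed.

Lemma smoment_divided_difference tau l k : 0 < tau -> admissible tau l -> stieltjes l 1 = 1 ->
  smoment (divided_difference l) k - smoment (divided_difference l) (S k) =
  / INR (S k) - smoment l (S k).
Proof.
intros Ht A E1. pose proof (admissible_divided_difference _ _ Ht A) as A'.
pose proof (is_RInt_minus _ _ _ _ _ _ (is_RInt_smoment _ _ k Ht A') (is_RInt_smoment _ _ (S k) Ht A')) as I.
pose proof (is_RInt_minus _ _ _ _ _ _ (is_RInt_pow_unit k) (is_RInt_succ_moment _ _ k Ht A)) as J.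
refine (is_RInt_inj _ _ _ _ _ (is_RInt_ext _ _ _ _ _ _ I) J).
intros x. rewrite Rmin_left, Rmax_right by lra. intros Hx.
pose proof (divided_difference_spec tau l x Ht A ltac:(lra)) as D. rewrite E1 in D.
change (x ^ k * stieltjes (divided_difference l) x - x * x ^ k * stieltjes (divided_difference l) x =
  x ^ k - x ^ k * (x * stieltjes l x)).
transitivity (x ^ k * ((1 - x) * stieltjes (divided_difference l) x)); [ring|]. rewrite D; ring.
Qed.

(** With [sigma = 1 - s], x F(x) is close to x^s, so the divided difference of F stands for (1 -
    x^s) / (1 - x). At x = 0 it equals F(1) = 1. *)
Lemma moment_approx_power (s eps : R) : 0 <= s <= 1 -> 0 < eps ->
  exists tau l, 0 < tau /\ admissible tau l /\ stieltjes l 0 <= 1 /\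
    forall k, Rabs (smoment l k - smoment l (S k) - (/ INR (S k) - / (INR (S k) + s))) <= eps.
Proof.
intros Hs He. set (eta := Rmin (/ 2) (eps / 4)).
assert (H1 : eta <= / 2) by apply Rmin_l. assert (H2 : eta <= eps / 4) by apply Rmin_r.
assert (H3 : 0 < eta) by (apply Rmin_pos; lra).
destruct (stieltjes_approx_Rpower (1 - s) eta (eps / 2) ltac:(lra) ltac:(lra) ltac:(lra))
  as (tau & l & Ht & A & E1 & H).
replace (1 - (1 - s)) with s in H by ring.
exists tau, (divided_difference l). split; [|split; [|split]]; auto using admissible_divided_difference.
- pose proof (divided_difference_spec tau l 0 Ht A (Rle_refl 0)) as D. lra.
- intros k. rewrite (smoment_divided_difference tau) by auto.
  pose proof (smoment_succ_near tau s eta (eps / 2) l k Ht A E1 (proj1 Hs) ltac:(lra) ltac:(lra) H) as N.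
  rewrite <- Rabs_Ropp. eapply Rle_trans; [|eapply Rle_trans; [exact N|lra]].
  right; f_equal; ring.
Qed.

Lemma smoment_app l l' k : smoment (l ++ l') k = smoment l k + smoment l' k.
Proof. induction l as [|p l IH]; simpl; [ring|]. rewrite IH; ring. Qed.

Lemma smoment_rescale c l k : smoment (rescale c l) k = c * smoment l k.
Proof. induction l as [|p l IH]; simpl; [ring|]. rewrite IH; ring. Qed.

Lemma admissible_weaken tau tau' l : tau' <= tau -> admissible tau l -> admissible tau' l.
Proof. intros Ht H. eapply Forall_impl; [|exact H]. intros p; simpl; lra. Qed.

Lemma admissible_app tau tau' l l' : admissible tau l -> admissible tau' l' ->
  admissible (Rmin tau tau') (l ++ l').
Proof.
intros H H'. apply Forall_app; split.
- exact (admissible_weaken _ _ _ (Rmin_l _ _) H).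
- exact (admissible_weaken _ _ _ (Rmin_r _ _) H').
Qed.

(* A Riemann sum over [s = i / J] of the approximants of [1/(k+1) - 1/(k+1+s)], whose
   integral over [0 <= s <= 1] is [1/(k+1) - ln ((k+2)/(k+1))]. *)
Lemma moment_riemann_sum (J : nat) (eps : R) : (1 <= J)%nat -> 0 < eps -> forall i, (i <= J)%nat ->
  exists tau l, 0 < tau /\ admissible tau l /\ stieltjes l 0 <= INR i /\
    forall k, Rabs (smoment l k - smoment l (S k) -
      (INR i / INR (S k) - INR J * (ln (INR (S k) + INR i / INR J) - ln (INR (S k)))))
    <= INR i * (eps + / INR J).
Proof.
intros HJ He. assert (PJ : 0 < INR J) by (apply lt_0_INR; lia).
induction i as [|i IH]; intros Hi.
- exists 1, nil. split; [lra|]. split; [constructor|]. split; [simpl; lra|].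
  intros k. simpl smoment. simpl (INR 0). unfold Rdiv. rewrite !Rmult_0_l, Rplus_0_r.
  match goal with |- Rabs ?y <= _ => replace y with 0 by ring end. rewrite Rabs_R0; lra.
- destruct (IH ltac:(lia)) as (tau & l & Ht & A & B & C).
  destruct (moment_approx_power (INR i / INR J) eps) as (tau' & l' & Ht' & A' & B' & C'); auto.
  { split; [apply Rle_mult_inv_pos; auto using pos_INR|]. apply Rle_div_l; auto.
    rewrite Rmult_1_l. apply le_INR; lia. }
  exists (Rmin tau tau'), (l ++ l'). split; [now apply Rmin_pos|].
  split; [now apply admissible_app|]. rewrite (S_INR i). split; [rewrite stieltjes_app; lra|].
  intros k. rewrite !smoment_app.
  set (y := INR (S k) + INR i / INR J).
  assert (P1 : 1 <= INR (S k)) by (rewrite S_INR; pose proof (pos_INR k); lra).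
  assert (Hy : 1 <= y).
  { assert (0 <= INR i / INR J) by (apply Rle_mult_inv_pos; auto using pos_INR). unfold y; lra. }
  assert (PyJ : 0 < INR J * y) by (apply Rmult_lt_0_compat; lra).
  (* After scaling by [J], the unit step from [J y] to [J y + 1] is the cell from [y] to [y']. Thus
     [J (ln y' - ln y)] lies between [/ y'] and [/ y], which differ by at most [/ J] as both points
     are at least 1. *)
  pose proof (ln_succ_bounds (INR J * y) PyJ) as L.
  replace (INR J * y + 1) with (INR J * (INR (S k) + (INR i + 1) / INR J)) in L by (unfold y; field; lra).
  set (y' := INR (S k) + (INR i + 1) / INR J) in *.
  assert (Hy' : y' = y + / INR J) by (unfold y', y; field; lra).
  assert (0 < / INR J) by now apply Rinv_0_lt_compat.
  rewrite !ln_mult in L by lra.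
  assert (L' : / y' <= INR J * (ln y' - ln y) <= / y).
  { replace (/ y') with (INR J * / (INR J * y')) by (field; lra).
    replace (/ y) with (INR J * / (INR J * y)) by (field; lra).
    split; apply Rmult_le_compat_l; lra. }
  assert (Q : / y - / y' <= / INR J).
  { replace (/ y - / y') with (/ INR J * / (y * y')) by (rewrite Hy'; field; repeat split; nra).
    rewrite <- (Rmult_1_r (/ INR J)) at 2. apply Rmult_le_compat_l; [lra|].
    rewrite <- Rinv_1. apply Rinv_le_contravar; nra. }
  specialize (C k). specialize (C' k). fold y in C, C'.
  apply Rabs_le_between in C. apply Rabs_le_between in C'. apply Rabs_le.
  unfold Rdiv in *. rewrite (Rmult_plus_distr_r (INR i) 1 (/ INR (S k))).
  rewrite Rmult_plus_distr_r. lra.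
Qed.

Lemma moment_approx (eps : R) : 0 < eps ->
  exists tau l, 0 < tau /\ admissible tau l /\ stieltjes l 0 <= 1 /\
    forall k, Rabs (smoment l k - smoment l (S k) -
      (/ INR (S k) - (ln (INR (S k) + 1) - ln (INR (S k))))) <= eps.
Proof.
intros He. destruct (archimed_cor1 (eps / 2) ltac:(lra)) as (J & HJ & PJ).
destruct (moment_riemann_sum J (eps / 2) PJ ltac:(lra) J ltac:(lia)) as (tau & l & Ht & A & B & C).
apply lt_0_INR in PJ. pose proof (Rinv_0_lt_compat _ PJ) as VJ.
exists tau, (rescale (/ INR J) l). split; auto.
split; [apply admissible_rescale; auto; lra|]. split.
- rewrite stieltjes_rescale, <- (Rinv_l (INR J)) by lra. apply Rmult_le_compat_l; lra.
- intros k. rewrite !smoment_rescale. specialize (C k).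
  replace (INR J / INR J) with 1 in C by (field; lra).
  apply (Rmult_le_compat_l (/ INR J)) in C; [|lra].
  rewrite <- Rmult_assoc, Rinv_l, Rmult_1_l in C by lra.
  rewrite <- (Rabs_pos_eq (/ INR J)) in C at 1 by lra. rewrite <- Rabs_mult in C.
  eapply Rle_trans; [|eapply Rle_trans; [exact C|lra]].
  right; f_equal. pose proof (not_0_INR (S k) ltac:(lia)). field; lra.
Qed.

(** A positive sum of kernels decreases on [0, 1], so its value at 0 bounds it. This controls the
    tail in [gap_approx] uniformly over all approximants. *)
Lemma smoment_bounds tau l k : 0 < tau -> admissible tau l -> stieltjes l 0 <= 1 ->
  0 <= smoment l k <= / INR (S k).
Proof.
intros Ht A H0.
assert (B : forall x, 0 <= x -> 0 <= stieltjes l x <= stieltjes l 0).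
{ intros x Hx. clear H0. induction A as [|[rho t] l [H1 H2] _ IH]; simpl in *; [lra|].
  assert (0 <= rho / (x + t)) by (apply Rle_mult_inv_pos; lra).
  assert (rho / (x + t) <= rho / (0 + t)).
  { apply Rmult_le_compat_l; auto. apply Rinv_le_contravar; lra. }
  lra. }
pose proof (is_RInt_smoment tau l k Ht A) as I. split.
- apply (is_RInt_ge_0 _ 0 1 _ Rle_0_1 I). intros x Hx.
  apply Rmult_le_pos; [apply pow_le; lra | apply B; lra].
- apply (is_RInt_le _ _ 0 1 _ _ Rle_0_1 I (is_RInt_pow_unit k)). intros x Hx.
  rewrite <- (Rmult_1_r (x ^ k)) at 2. apply Rmult_le_compat_l; [apply pow_le; lra|].
  pose proof (B x ltac:(lra)); lra.
Qed.

(** * The sequence gamma - S_k *)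

Definition gap (k : nat) : R := Euler_gamma - S_seq k.

Lemma S_seq_succ k : S_seq (S k) - S_seq k = / INR (S k) - (ln (INR (S k) + 1) - ln (INR (S k))).
Proof.
unfold S_seq. rewrite harmonic_S, !Nat.add_1_r, (S_INR (S k)). ring.
Qed.

Lemma is_lim_seq_S_seq : is_lim_seq S_seq Euler_gamma.
Proof.
assert (V : is_lim_seq (fun n => / INR (S n)) 0).
{ apply (is_lim_seq_incr_1 (fun n => / INR n)).
  apply (is_lim_seq_inv _ p_infty); [apply is_lim_seq_INR | discriminate]. }
apply is_lim_seq_incr_1.
apply is_lim_seq_le_le with (fun n => harmonic (S n) - ln (INR (S n)) - / INR (S n))
  (fun n => harmonic (S n) - ln (INR (S n))).
- intros n. unfold S_seq. rewrite Nat.add_1_r, (S_INR (S n)).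
  pose proof (lt_0_INR (S n) ltac:(lia)) as P.
  pose proof (ln_succ_bounds (INR (S n)) P).
  assert (0 < / (INR (S n) + 1)) by (apply Rinv_0_lt_compat; lra). lra.
- replace (Finite Euler_gamma) with (Finite (Euler_gamma - 0)) by (f_equal; ring).
  apply is_lim_seq_minus'; auto.
  exact (proj1 (is_lim_seq_incr_1 _ _) is_lim_seq_Euler_gamma).
- exact (proj1 (is_lim_seq_incr_1 _ _) is_lim_seq_Euler_gamma).
Qed.

(** [S_k] increases and [S_k + 1/(k+1)] decreases, both to Euler's constant. *)
Lemma gap_bounds k : 0 <= gap k <= / INR (S k).
Proof.
unfold gap. split.
- enough (S_seq k <= Euler_gamma) by lra.
  apply is_lim_seq_incr_compare; [apply is_lim_seq_S_seq|]. intros n.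
  pose proof (S_seq_succ n). pose proof (ln_succ_bounds _ (lt_0_INR (S n) ltac:(lia))). lra.
- enough (Euler_gamma <= S_seq k + / INR (S k)) by lra.
  apply (is_lim_seq_decr_compare (fun k => S_seq k + / INR (S k))).
  + replace (Finite Euler_gamma) with (Finite (Euler_gamma + 0)) by (f_equal; ring).
    apply is_lim_seq_plus'; [apply is_lim_seq_S_seq|].
    apply (is_lim_seq_incr_1 (fun n => / INR n)).
    apply (is_lim_seq_inv _ p_infty); [apply is_lim_seq_INR | discriminate].
  + intros n. pose proof (S_seq_succ n). pose proof (ln_succ_bounds _ (lt_0_INR (S n) ltac:(lia))).
    rewrite (S_INR (S n)). lra.
Qed.

(** The source of the strict inequality in the theorem. [gap_bounds] at 0 gives only [<= 1]; one
    step further, gap 0 = gap 1 + 1 - ln 2 <= 3/2 - ln 2, and ln 2 > 1/2. *)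
Lemma gap_0_lt_1 : 0 <= gap 0 < 1.
Proof.
pose proof (gap_bounds 0). pose proof (gap_bounds 1). pose proof (S_seq_succ 0) as E.
pose proof ln_lt_2. unfold gap in *. simpl INR in *. rewrite ln_1 in E.
replace (1 + 1) with 2 in * by ring. lra.
Qed.

(** [moment_approx] matches only consecutive differences. Telescoping over [K] steps costs [K] times
    its error, here [eps / 2] in total, and at index [k + K] both sequences lie between 0 and
    [1/(k+K+1)]. As [K] does not depend on [k], the approximation is uniform. *)
Lemma gap_approx (eps : R) : 0 < eps ->
  exists tau l, 0 < tau /\ admissible tau l /\ forall k, Rabs (smoment l k - gap k) <= eps.
Proof.
intros He. destruct (archimed_cor1 (eps / 2) ltac:(lra)) as (K & HK & PK).
apply lt_0_INR in PK. pose proof (Rinv_0_lt_compat _ PK).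
destruct (moment_approx (eps / 2 * / INR K)) as (tau & l & Ht & A & B & C).
{ apply Rmult_lt_0_compat; lra. }
exists tau, l. split; auto. split; auto.
assert (D : forall j k, Rabs (smoment l k - gap k) <= INR j * (eps / 2 * / INR K) + / INR (S (k + j))).
{ induction j as [|j IH]; intros k.
  - simpl (INR 0). rewrite Rmult_0_l, Rplus_0_l, Nat.add_0_r.
    pose proof (smoment_bounds tau l k Ht A B). pose proof (gap_bounds k). apply Rabs_le; lra.
  - specialize (IH (S k)). specialize (C k). rewrite <- S_seq_succ in C.
    replace (S k + j)%nat with (k + S j)%nat in IH by lia. rewrite S_INR.
    replace (smoment l k - gap k) with
      ((smoment l k - smoment l (S k) - (S_seq (S k) - S_seq k)) + (smoment l (S k) - gap (S k)))
      by (unfold gap; ring).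
    eapply Rle_trans; [apply Rabs_triang|]. lra. }
intros k. eapply Rle_trans; [apply (D K)|].
replace (INR K * (eps / 2 * / INR K)) with (eps / 2) by (field; lra).
assert (/ INR (S (k + K)) <= / INR K).
{ apply Rinv_le_contravar; auto. apply le_INR; lia. }
lra.
Qed.

(** * The bound for gamma - S_k *)

Lemma functional_plus a b c r n u v :
  functional a b c r n (fun k => u k + v k) = functional a b c r n u + functional a b c r n v.
Proof.
unfold functional. rewrite <- Rmult_plus_distr_l, <- sum_plus. f_equal. apply sum_eq. intros; ring.
Qed.

Lemma functional_scal a b c r n x u :
  functional a b c r n (fun k => x * u k) = x * functional a b c r n u.
Proof.
unfold functional. rewrite <- Rmult_assoc, (Rmult_comm x), Rmult_assoc. f_equal.
rewrite scal_sum. apply sum_eq. intros; ring.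
Qed.

(** The binomial weight has leading coefficient r^N / N! with N = c n. The alternating sum
    multiplies it by N!, and the prefactor removes r^N. *)
Lemma functional_one a b c r n : (1 <= r)%nat -> functional a b c r n (fun _ => 1) = 1.
Proof.
intros Hr. assert (INR r ^ (c * n) <> 0) by (apply pow_nonzero, not_0_INR; lia).
unfold functional.
pose proof (alternating_sum_poly_seq _ _ _ (poly_seq_C r (c * n) ((a + c) * n) ltac:(nia))) as H0.
rewrite (sum_eq _ (fun k => (-1) ^ (k + c * n) * Binomial.C (c * n) k *
  Binomial.C (r * k + (a + c) * n) (c * n))) by (intros; ring).
rewrite H0. field. split; auto using INR_fact_neq_0.
Qed.

Lemma functional_dist_le a b c r n :
  exists W, 0 <= W /\ forall u v eps, (forall k, Rabs (u k - v k) <= eps) ->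
    Rabs (functional a b c r n u - functional a b c r n v) <= W * eps.
Proof.
set (w := fun k => (-1) ^ (k + c * n) * Binomial.C (c * n) k * Binomial.C (r * k + (a + c) * n) (c * n)).
exists (Rabs (/ INR r ^ (c * n)) * sum_f_R0 (fun k => Rabs (w k)) (c * n)). split.
- apply Rmult_le_pos; [apply Rabs_pos|]. apply cond_pos_sum. intros; apply Rabs_pos.
- intros u v eps H. unfold functional. rewrite <- Rmult_minus_distr_l, <- minus_sum, Rabs_mult, Rmult_assoc.
  apply Rmult_le_compat_l; [apply Rabs_pos|].
  eapply Rle_trans; [apply Rsum_abs|]. rewrite Rmult_comm, scal_sum. apply sum_Rle.
  intros k _. rewrite <- Rmult_minus_distr_l, Rabs_mult.
  apply Rmult_le_compat_l; [apply Rabs_pos | apply H].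
Qed.

Lemma functional_smoment_le (a b c r n : nat) (tau : R) (l : list (R * R)) :
  (1 <= b)%nat -> (1 <= r)%nat ->
  (a <= b)%nat -> (b - a <= c)%nat -> 0 < tau -> admissible tau l ->
  Rabs (functional a b c r n (smoment l)) <= rate a b c r ^ n * smoment l 0.
Proof.
intros Hb Hr Hab Habc Ht A. induction A as [|[rho t] l [H1 H2] _ IH].
- replace (functional a b c r n (smoment nil)) with (functional a b c r n (fun _ => 0 * 0)) by
    (unfold functional; do 2 f_equal; simpl; rewrite Rmult_0_l; reflexivity).
  rewrite (functional_scal a b c r n 0 (fun _ => 0)), Rmult_0_l, Rabs_R0. simpl; lra.
- simpl in H1, H2.
  change (smoment ((rho, t) :: l)) with (fun k => rho * moment t k 1 + smoment l k).
  rewrite functional_plus, (functional_scal a b c r n rho (fun k => moment t k 1)).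
  eapply Rle_trans; [apply Rabs_triang|]. rewrite Rabs_mult, (Rabs_pos_eq rho) by auto.
  pose proof (functional_moment_le a b c r n t Hb Hr Hab Habc ltac:(lra)) as M.
  apply (Rmult_le_compat_l rho) in M; auto. lra.
Qed.

Lemma rate_pos a b c r : 0 < rate a b c r.
Proof.
unfold rate. apply Rdiv_lt_0_compat; [|apply exp_pos].
apply Rmult_lt_0_compat; [apply Rmult_lt_0_compat|]; try apply exp_pos; apply pow_self_pos.
Qed.

Lemma functional_gap_le (a b c r n : nat) :
  (1 <= b)%nat -> (1 <= r)%nat -> (a <= b)%nat -> (b - a <= c)%nat ->
  Rabs (functional a b c r n gap) <= rate a b c r ^ n * gap 0.
Proof.
intros Hb Hr Hab Habc.
pose proof (pow_lt _ n (rate_pos a b c r)) as HM. set (M := rate a b c r ^ n) in *.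
destruct (functional_dist_le a b c r n) as (W & HW & D).
apply le_epsilon. intros eps He.
(* Replacing [gap] by the approximant costs [W] times the error in the functional and [M] times the
   error in the value at 0. *)
destruct (gap_approx (eps / (M + W))) as (tau & l & Ht & A & B).
{ apply Rdiv_lt_0_compat; lra. }
pose proof (functional_smoment_le a b c r n tau l Hb Hr Hab Habc Ht A) as F. fold M in F.
pose proof (D _ _ _ B) as E. pose proof (B 0%nat) as B0.
assert (X : M * (eps / (M + W)) + W * (eps / (M + W)) = eps) by (field; lra).
set (e := eps / (M + W)) in *.
apply Rabs_le_between in E. apply Rabs_le_between in B0. apply Rabs_le_between in F.
assert (M * (smoment l 0 - gap 0) <= M * e) by (apply Rmult_le_compat_l; lra).
apply Rabs_le. lra.
Qed.

Theorem theorem2 (a b c r : nat)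
  (hb : (1 <= b)%nat) (hc : (1 <= c)%nat) (hr : (1 <= r)%nat)
  (hab : (a <= b)%nat) (habc : (b - a <= c)%nat)
  (n : nat) (hn : (1 <= n)%nat) :
  Rabs (Euler_gamma -
        / INR r ^ (c * n) *
        sum_n_m (fun k : nat =>
          (-1) ^ (k + c * n) * Binomial.C (c * n) k *
          Binomial.C (r * k + (a + c) * n) (c * n) *
          S_seq (r * k + b * n)) 0 (c * n))
  < (Rpower (INR b) (INR b / INR r) *
     INR (c + a - b) ^ (c + a - b) *
     INR (b - a) ^ (b - a) /
     Rpower (INR (b + c * r)) (INR c + INR b / INR r)) ^ n.
Proof.
fold (rate a b c r).
match goal with |- Rabs (_ - _ * sum_n_m ?f 0 ?N) < _ => change (sum_n_m f 0 N) with (sum_n f N) end.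
rewrite sum_n_Reals. fold (functional a b c r n S_seq).
(* The weights sum to 1, so Euler's constant is the functional of a constant sequence and linearity
   applies. *)
assert (E : Euler_gamma - functional a b c r n S_seq = functional a b c r n gap).
{ change gap with (fun k => Euler_gamma - S_seq k).
  replace (functional a b c r n (fun k => Euler_gamma - S_seq k)) with
    (functional a b c r n (fun k => Euler_gamma * 1 + -1 * S_seq k)).
  - rewrite (functional_plus a b c r n (fun _ => Euler_gamma * 1) (fun k => -1 * S_seq k)).
    rewrite (functional_scal a b c r n Euler_gamma (fun _ => 1)), functional_one, functional_scal by auto.
    ring.
  - unfold functional. f_equal. apply sum_eq. intros; ring. }
rewrite E. eapply Rle_lt_trans; [now apply functional_gap_le|].
pose proof (pow_lt _ n (rate_pos a b c r)). pose proof gap_0_lt_1. nra.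
Qed.
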